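(* Let $\mathbb{X},\mathbb{Y}$ be finite dimensional real Hilbert spaces, let $\ell:\mathbb{Y}\to\mathbb{R}$ be a function that is strongly convex on any compact convex set and has locally Lipschitz gradient, let $\mathcal{A}:\mathbb{X}\to\mathbb{Y}$ be a linear map, and let $v\in\mathbb{X}$. Consider the function $$h(x):=\ell(\mathcal{A}x)+\langle v,x\rangle+\sigma_{\mathfrak{D}}(x)$$ with $\mathfrak{D}\subseteq\mathbb{X}$ a nonempty $C^2$-cone reducible closed convex set. Suppose $0\in\partial h(\bar x)$. Then $$\bar x\in N_{\mathfrak{D}}\big(-\mathcal{A}^*\nabla\ell(\mathcal{A}\bar x)-v\big).$$ If in addition $\big\{\mathcal{A}^{-1}\{\mathcal{A}\bar x\},\ N_{\mathfrak{D}}(-\mathcal{A}^*\nabla\ell(\mathcal{A}\bar x)-v)\big\}$ is boundedly linearly regular at $\bar x$, then $h$ satisfies the KL property at $\bar x$ with exponent $\frac12$.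
   Context: $\sigma_{\mathfrak{D}}(x):=\sup_{z\in\mathfrak{D}}\langle x,z\rangle$ is the support function; $N_{\mathfrak{D}}(x)=\partial\delta_{\mathfrak{D}}(x)$ is the normal cone at $x\in\mathfrak{D}$, where $\delta_{\mathfrak{D}}$ is the indicator function; $\mathcal{A}^*$ is the adjoint; $B(x,r)$ is the closed ball. A closed set $\mathfrak{D}\subseteq\mathbb{X}$ is $C^2$-cone reducible at $\bar w\in\mathfrak{D}$ if there exist a finite dimensional Hilbert space $\mathbb{V}$, a closed convex pointed cone $K\subseteq\mathbb{V}$, $\rho>0$ and a mapping $\Theta:\mathbb{X}\to\mathbb{V}$ with $\Theta(\bar w)=0$, twice continuously differentiable in $B(\bar w,\rho)$, with derivative $D\Theta(\bar w)$ onto, such that $\mathfrak{D}\cap B(\bar w,\rho)=\{w:\Theta(w)\in K\}\cap B(\bar w,\rho)$. It is $C^2$-cone reducible if this holds at every $\bar w\in\mathfrak{D}$. A pair $\{\mathfrak{D}_1,\mathfrak{D}_2\}$ is boundedly linearly regular at $\bar x\in\mathfrak{D}_1\cap\mathfrak{D}_2$ if for any bounded neighborhood $\mathfrak{U}$ of $\bar x$ there exists $c>0$ such that $\operatorname{dist}(x,\mathfrak{D}_1\cap\mathfrak{D}_2)\le c[\operatorname{dist}(x,\mathfrak{D}_1)+\operatorname{dist}(x,\mathfrak{D}_2)]$ for all $x\in\mathfrak{U}$. A function $h:\mathbb{X}\to\mathbb{R}\cup\{\infty\}$ is proper if $\operatorname{dom}h:=\{x:h(x)<\infty\}\neq\emptyset$,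 and closed if it is lower semicontinuous. For proper convex $h$, $\partial h$ is the usual convex subdifferential (in general the limiting subdifferential, which coincides with it for convex functions), with $\partial h(x)=\emptyset$ for $x\notin\operatorname{dom}h$, and $\operatorname{dom}\partial h:=\{x:\partial h(x)\ne\emptyset\}$. Write $\operatorname{dist}(x,D):=\inf_{y\in D}\|x-y\|$ (with value $\infty$ if $D=\emptyset$). A proper closed $h$ satisfies the Kurdyka-Łojasiewicz (KL) property at $\hat x\in\operatorname{dom}\partial h$ with exponent $\alpha\in[0,1)$ if there exist $a\in(0,\infty]$, a neighborhood $V$ of $\hat x$ and $\bar c>0$ such that, with $\varphi(s)=\bar c s^{1-\alpha}$, $\varphi'(h(x)-h(\hat x))\operatorname{dist}(0,\partial h(x))\ge1$ for every $x\in V$ with $h(\hat x)<h(x)<h(\hat x)+a$. *)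

(* Defs.v *)
From HB Require Import structures.
From mathcomp Require Import all_boot all_order all_algebra.
From mathcomp Require Import sesquilinear.
From mathcomp Require Import all_classical all_reals all_analysis.

Set Implicit Arguments.
Unset Strict Implicit.
Unset Printing Implicit Defensive.

Import Order.TTheory GRing.Theory Num.Theory.
Import numFieldNormedType.Exports.

Local Open Scope classical_set_scope.
Local Open Scope ring_scope.

(* Finite-dimensional real Hilbert spaces: the norm (hence the topology) is
   the one induced by the inner product; completeness is automatic. *)
HB.mixin Record NormedModule_isFinHilbert (R : realType) V
    of NormedModule R V & Vector R V := {
  dot : {dot V for idfun};
  sqr_norm_dot : forall x : V, `|x| ^+ 2 = dot x x
}.

#[short(type="finHilbertType")]
HB.structure Definition FinHilbert (R : realType) :=
  {V of NormedModule R V & Vector R V & NormedModule_isFinHilbert R V}.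

Section Calculus.
Context {R : realType}.
Implicit Types X Y : finHilbertType R.

(* Riesz representative of the differential; meaningful where [f] is
   differentiable, and unique there. *)
Definition grad X (f : X -> R) (x : X) : X :=
  xget 0 [set g : X | forall u : X, 'd f x u = dot g u].

Definition adjoint X Y (A : {linear X -> Y}) (y : Y) : X :=
  xget 0 [set x : X | forall u : X, dot (A u) y = dot u x].

Definition locally_lipschitz X Y (f : X -> Y) : Prop :=
  forall x : X, exists2 U, nbhs x U & [lipschitz f y | y in U].

Definition strongly_convex_on X (K : set X) (f : X -> R) : Prop :=
  exists2 mu : R, 0 < mu & forall (x y : X) (t : R),
    K x -> K y -> 0 <= t <= 1 ->
    f (t *: x + (1 - t) *: y) <=
      t * f x + (1 - t) * f y - mu / 2 * t * (1 - t) * `|x - y| ^+ 2.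

(* For open [U]. The spaces being finite-dimensional, continuity of the
   differential in operator norm is continuity of [y |-> 'd f y u] for every
   direction [u]; likewise for second derivatives. *)
Definition C1_on X Y (U : set X) (f : X -> Y) : Prop :=
  forall x : X, U x -> differentiable f x /\
    forall u : X, {for x, continuous (fun y => 'd f y u)}.

Definition C2_on X Y (U : set X) (f : X -> Y) : Prop :=
  C1_on U f /\ forall u : X, C1_on U (fun y => 'd f y u).

End Calculus.

Section ConvexAnalysis.
Context {R : realType} {X : finHilbertType R}.
Local Open Scope ereal_scope.

Definition proper (f : X -> \bar R) : Prop :=
  (forall x, f x != -oo) /\ exists x, f x < +oo.

(* The convex subdifferential; it is empty outside the domain of [f]. *)
Definition subdifferential (f : X -> \bar R) (x : X) : set X :=
  [set g | f x \is a fin_num /\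
           forall y : X, f x + (dot g (y - x)%R)%:E <= f y].

Definition indicator_function (D : set X) (x : X) : \bar R :=
  if x \in D then 0 else +oo.

Definition normal_cone (D : set X) (x : X) : set X :=
  subdifferential (indicator_function D) x.

Definition support_function (D : set X) (x : X) : \bar R :=
  ereal_sup [set (dot x z)%:E | z in D].

Definition dist (x : X) (D : set X) : \bar R :=
  ereal_inf [set `|x - y|%:E | y in D].

Definition boundedly_linearly_regular (D1 D2 : set X) (xbar : X) : Prop :=
  (D1 `&` D2) xbar /\
  forall U : set X, nbhs xbar U -> bounded_set U ->
    exists2 c : R, (0 < c)%R & forall x, U x ->
      dist x (D1 `&` D2) <= c%:E * (dist x D1 + dist x D2).

Definition KL_property (h : X -> \bar R) (alpha : R) (xhat : X) : Prop :=
  [/\ proper h, lower_semicontinuous h, subdifferential h xhat !=set0,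
      (0 <= alpha < 1)%R &
  exists (a : \bar R) (c : R) (V : set X),
    [/\ 0 < a, (0 < c)%R, nbhs xhat V &
    forall x, V x -> h xhat < h x -> h x < h xhat + a ->
      let phi := fun s : R => (c * s `^ (1 - alpha))%R in
      1 <= (derive1 phi (fine (h x - h xhat)))%:E *
           dist 0%R (subdifferential h x)]].

End ConvexAnalysis.

Section ConeReducible.
Context {R : realType}.

Definition is_cone (V : finHilbertType R) (K : set V) : Prop :=
  forall (t : R) (z : V), 0 <= t -> K z -> K (t *: z).

Definition pointed (V : finHilbertType R) (K : set V) : Prop :=
  K `&` [set - z | z in K] = [set 0].

(* [Theta] is C^2 "in the closed ball" in the usual sense: on some open set
   containing it. *)
Definition C2_cone_reducible_at (X : finHilbertType R) (D : set X) (w : X) :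
    Prop :=
  exists (V : finHilbertType R) (K : set V) (rho : R) (Theta : X -> V),
    [/\ [/\ closed K, convex_set K, is_cone K & pointed K],
        0 < rho,
        Theta w = 0,
        (exists U : set X,
           [/\ open U, closed_ball w rho `<=` U & C2_on U Theta]) &
        range ('d Theta w) = setT /\
        D `&` closed_ball w rho = (Theta @^-1` K) `&` closed_ball w rho].

Definition C2_cone_reducible (X : finHilbertType R) (D : set X) : Prop :=
  forall w, D w -> C2_cone_reducible_at D w.

End ConeReducible.

(* Main.v *)
(* Let [w] be minus the gradient at [xbar] of the smooth part of [h].  For [xi]
   in the subdifferential of [h] at [x], the point
   [z = xi - A^* grad ell (A x) - v] lies in [D] and [x] is normal to [D] at [z].
   Cone reducibility makes the normal cones calm:
   dist(x, N_D(w)) <= kappa |z - w| |x| for [z] near [w].  Indeed the distance is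
   <x, u> / |u| for the projection [u] of [x] onto the tangent cone of [D] at
   [w]; metric regularity of the reduction map [Theta] moves [z + t u] to a point
   of [D] at distance O(t |z - w| |u|), and normality of [x] at [z] then bounds
   <x, u>.
   Bounded linear regularity therefore bounds the distance [d] of [x] to
   A^-1{A xbar} `&` N_D(w) by a multiple of |A x - A xbar| + |xi|, while strong
   convexity of [ell] and monotonicity of the normal cone give
   mu |A x - A xbar|^2 <= |xi| d.  Hence d = O(|xi|), and the subgradient
   inequality yields h x - h xbar <= |xi| d = O(|xi|^2). *)
Require Import Defs.
From HB Require Import structures.
From mathcomp Require Import all_boot all_order all_algebra.
From mathcomp Require Import sesquilinear.
From mathcomp Require Import all_classical all_reals all_analysis.
From mathcomp Require Import ring lra.
Set Implicit Arguments.
Unset Strict Implicit.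
Unset Printing Implicit Defensive.

Import Order.TTheory GRing.Theory Num.Theory.
Import numFieldNormedType.Exports.

Local Open Scope classical_set_scope.
Local Open Scope ring_scope.

(** * Inner product algebra, Cauchy-Schwarz and Riesz representation *)

Section InnerProduct.
Context {R : realType} {X : finHilbertType R}.
Implicit Types x y z : X.

Lemma dotC x y : dot x y = dot y x.
Proof. by rewrite hermC /= expr0 mul1r. Qed.

Lemma dotDl x y z : dot (x + y) z = dot x z + dot y z.
Proof. exact: linearDl. Qed.
Lemma dotDr x y z : dot z (x + y) = dot z x + dot z y.
Proof. exact: linearDr. Qed.
Lemma dotBl x y z : dot (x - y) z = dot x z - dot y z.
Proof. exact: linearBl. Qed.
Lemma dotBr x y z : dot z (x - y) = dot z x - dot z y.
Proof. exact: linearBr. Qed.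
Lemma dotNl x z : dot (- x) z = - dot x z.
Proof. exact: linearNl. Qed.
Lemma dotNr x z : dot z (- x) = - dot z x.
Proof. exact: linearNr. Qed.
Lemma dotZl k x z : dot (k *: x) z = k * dot x z.
Proof. exact: linearZl_LR. Qed.
Lemma dotZr k x z : dot z (k *: x) = k * dot z x.
Proof. exact: linearZr_LR. Qed.
Lemma dot0l z : dot 0 z = 0. Proof. exact: linear0l. Qed.
Lemma dot0r z : dot z 0 = 0. Proof. exact: linear0r. Qed.

Lemma dot_sumr I (r : seq I) (F : I -> X) z :
  dot z (\sum_(i <- r) F i) = \sum_(i <- r) dot z (F i).
Proof. exact: (big_morph (dot z) (fun x y => dotDr x y z) (dot0r z)). Qed.

Lemma dotxx x : dot x x = `|x| ^+ 2. Proof. by rewrite sqr_norm_dot. Qed.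

Lemma sqr_normD x y : `|x + y| ^+ 2 = `|x| ^+ 2 + 2 * dot x y + `|y| ^+ 2.
Proof. by rewrite !sqr_norm_dot !dotDl !dotDr (dotC y x); ring. Qed.

Lemma sqr_normB x y : `|x - y| ^+ 2 = `|x| ^+ 2 - 2 * dot x y + `|y| ^+ 2.
Proof. by rewrite sqr_normD dotNr normrN; ring. Qed.

Lemma dot_le x y : dot x y <= `|x| * `|y|.
Proof.
have [->|y0] := eqVneq y 0; first by rewrite dot0r normr0 mulr0.
have [->|x0] := eqVneq x 0; first by rewrite dot0l normr0 mul0r.
have nx : 0 < `|x| by rewrite normr_gt0.
have ny : 0 < `|y| by rewrite normr_gt0.
(* This square expands to [2 |x| |y| (|x| |y| - dot x y)], and the factor in front is positive. *)
have := sqr_ge0 `| `|y| *: x - `|x| *: y|.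
rewrite sqr_normB !normrZ !normr_id dotZl dotZr.
rewrite (_ : _ + _ = 2 * (`|x| * `|y|) * (`|x| * `|y| - dot x y)); last by ring.
by rewrite pmulr_rge0 ?subr_ge0// !mulr_gt0.
Qed.

Lemma norm_dot_le x y : `|dot x y| <= `|x| * `|y|.
Proof. by rewrite ler_norml lerNl -dotNl -{1}(normrN x) !dot_le. Qed.

Lemma dot_eq0 x : (forall u, dot x u = 0) -> x = 0.
Proof. by move=> /(_ x)/eqP; rewrite dotxx sqrf_eq0 normr_eq0 => /eqP. Qed.

Lemma dot_eq x y : (forall u, dot x u = dot y u) -> x = y.
Proof.
by move=> xy; apply/eqP; rewrite -subr_eq0; apply/eqP/dot_eq0 => u;
   rewrite dotBl xy subrr.
Qed.

Lemma dot_continuous x : continuous (dot x).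
Proof.
move=> y; apply/cvgrPdist_lt => e e0; near=> z.
rewrite -dotBr (le_lt_trans (norm_dot_le _ _))//.
rewrite (@le_lt_trans _ _ ((`|x| + 1) * `|y - z|))//.
  by rewrite ler_wpM2r// lerDl.
rewrite -ltr_pdivlMl ?ltr_wpDl//.
by near: z; apply: cvgr_dist_lt => //; rewrite mulr_gt0 ?invr_gt0 ?ltr_wpDl.
Unshelve. all: by end_near. Qed.

(** Pairing with a basis is an injective linear map into row vectors of the same dimension, hence
    onto. A preimage of the row of values of [f] on the basis represents [f]. *)
Lemma riesz (f : {scalar X}) : exists g, forall u, f u = dot g u.
Proof.
pose b := vbasis {: X}.
pose phi0 (x : X) : 'rV[R]_(\dim {: X}) := \row_i dot x b`_i.
have phi_lin : linear phi0.
  by move=> k x y; apply/rowP => i; rewrite !mxE dotDl dotZl.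
pose Phi := GRing.isLinear.Build _ _ _ _ phi0 phi_lin.
pose phi : {linear X -> 'rV[R]_(\dim {: X})} := HB.pack phi0 Phi.
have dotb x y : (forall i, (i < \dim {: X})%N -> dot x b`_i = dot y b`_i) -> x = y.
  move=> xy; apply: dot_eq => u.
  rewrite (coord_vbasis (memvf u)) !dot_sumr; apply: eq_bigr => i _.
  by rewrite !dotZr xy.
have phi0E x u : linfun phi x = linfun phi u -> x = u.
  rewrite !lfunE /= => /rowP xu; apply: dotb => i il.
  by have := xu (Ordinal il); rewrite !mxE.
have kerphi : lker (linfun phi) == 0%VS.
  by apply/lker0P => x u; exact: phi0E.
have surj : limg (linfun phi) = fullv.
  apply/eqP; rewrite eqEdim subvf /= [X in (X <= _)%N](_ : _ = \dim {: X}).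
    by rewrite limg_dim_eq// (eqP kerphi) capv0.
  by rewrite dimvf /dim /= mul1n.
have /memv_imgP[g _ hg] : \row_i f b`_i \in limg (linfun phi).
  by rewrite surj memvf.
exists g => u; rewrite (coord_vbasis (memvf u)) linear_sum dot_sumr.
apply: eq_bigr => i _; rewrite linearZ dotZr /=; congr (_ * _).
by have /rowP/(_ i) := hg; rewrite lfunE /= !mxE.
Qed.

End InnerProduct.

(* Decides identities between linear combinations of vectors by pairing both
   sides with an arbitrary vector. *)
Ltac vector_ring :=
  apply: dot_eq => ?; rewrite ?(dotDl, dotBl, dotNl, dotZl, dot0l); ring.

(** * Boundedness of linear maps, and compactness, in finite dimension *)

Section FiniteDimension.
Context {R : realType}.
Implicit Types X Y : finHilbertType R.

(** Each coordinate functional is an inner product with some [g i], so Cauchy-Schwarz bounds every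
    term of the basis expansion of [f u]. *)
Lemma linear_bounded X (W : normedModType R) (f : {linear X -> W}) :
  exists2 C : R, 0 < C & forall u, `|f u| <= C * `|u|.
Proof.
have Ei (i : 'I_(\dim {: X})) : exists g : X, forall u,
    coord (vbasis {: X}) i u = dot g u.
  exact: (riesz (coord (vbasis {: X}) i)).
pose g i := projT1 (cid (Ei i)).
have gE i u : coord (vbasis {: X}) i u = dot (g i) u by rewrite /g; case: cid.
exists (1 + \sum_i `|g i| * `|f (vbasis {: X})`_i|).
  by rewrite ltr_wpDr// sumr_ge0// => i _; rewrite mulr_ge0.
move=> u; rewrite {1}(coord_vbasis (memvf u)) linear_sum.
rewrite (le_trans (ler_norm_sum _ _ _))//.
rewrite mulrDl mul1r ler_wpDl// mulr_suml; apply: ler_sum => i _.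
by rewrite linearZ normrZ gE mulrAC ler_wpM2r// norm_dot_le.
Qed.

Lemma linear_continuous_fd X (W : normedModType R) (f : {linear X -> W}) :
  continuous f.
Proof.
have [C C0 fC] := linear_bounded f.
apply: bounded_linear_continuous; apply/ex_bound; exists C.
apply/nbhs_normP; exists 1 => //= u /=; rewrite sub0r normrN => /ltW u1.
by rewrite (le_trans (fC u))// ler_piMr// ltW.
Qed.

(** The pseudo-inverse of [f] is linear, hence bounded, and is a section of [f] over its range. *)
Lemma linear_right_inverse X Y (f : {linear X -> Y}) :
  exists2 C : R, 0 < C & forall x, exists2 u, f u = f x & `|u| <= C * `|f x|.
Proof.
have [C C0 fC] := linear_bounded ((linfun f)^-1)%VF.
exists C => // x; exists (((linfun f)^-1)%VF (f x)); last exact: fC.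
have := @limg_lfunVK _ _ _ (linfun f) (f x); rewrite lfunE; apply.
by rewrite -(lfunE f x) memv_img// memvf.
Qed.

(** Heine-Borel is transported from row vectors: [phi] rebuilds a vector from its coordinates and is
    continuous, and [psi] reads the coordinates and is bounded. *)
Lemma bounded_closed_compact_fd X (A : set X) (M : R) :
  (forall x, A x -> `|x| <= M) -> closed A -> compact A.
Proof.
move=> AM Acl.
pose n := \dim {: X}; pose b := vbasis {: X}.
pose phi (r : 'rV[R]_n) : X := \sum_(i < n) r ord0 i *: b`_i.
have phic : continuous phi.
  apply: continuous_big => [|i _ r]; first exact: add_continuous.
  exact: (@cvgZr_tmp _ _ _ (nbhs r) _ _ _ _ (@coord_continuous R 1 n ord0 i r)).
pose psi (x : X) : 'rV[R]_n := \row_i coord b i x.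
have psiK x : phi (psi x) = x.
  rewrite [RHS](coord_vbasis (memvf x)); apply: eq_bigr => i _.
  by rewrite mxE.
have phiK r : psi (phi r) = r.
  apply/rowP => i; rewrite mxE /phi coord_sum_free//.
  exact: (basis_free (vbasisP _)).
have psi_lin : linear psi.
  by move=> k x y; apply/rowP => i; rewrite !mxE linearP.
pose Psi0 := GRing.isLinear.Build _ _ _ _ psi psi_lin.
pose Psi : {linear X -> 'rV[R]_n} := HB.pack psi Psi0.
have [C C0 psiC] := linear_bounded Psi.
have -> : A = phi @` (phi @^-1` A).
  apply/seteqP; split => x /=; last by case=> r Ar <-.
  by move=> Ax; exists (psi x); rewrite ?psiK.
apply: continuous_compact; first exact: continuous_subspaceT.
apply: bounded_closed_compact; last by apply: closed_comp.
exists (C * M); split=> [|N CMN r /= Ar]; first exact: num_real.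
apply: le_trans (ltW CMN); rewrite -(phiK r); apply: le_trans (psiC (phi r)) _.
by rewrite ler_wpM2l ?(ltW C0)// AM.
Qed.

Lemma compact_closed_ball_fd X (x : X) (r : R) :
  compact [set y | `|x - y| <= r].
Proof.
apply: (@bounded_closed_compact_fd _ _ (r + `|x|)) => [y /= yr|].
  rewrite -[y](subrK x) (le_trans (ler_normD _ _))//.
  by rewrite distrC lerD2r.
have nc : continuous (fun y : X => `|x - y|).
  by move=> y; apply: cvg_norm; apply: cvgB; [exact: cvg_cst|exact: cvg_id].
have := (continuous_closedP (fun y : X => `|x - y|)).1 nc _ (@closed_le _ r).
exact.
Qed.

End FiniteDimension.

(** * Inequalities obtained by letting a step size tend to zero *)

Lemma le0_of_le_small (R : realType) (a b e : R) : 0 < e ->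
  (forall t, 0 < t -> t <= e -> a <= t * b) -> a <= 0.
Proof.
move=> e0 H; rewrite leNgt; apply/negP => a0.
have b1 : 0 < `|b| + 1 by rewrite ltr_wpDl.
(* With this [t], the product [t * (|b| + 1)] is at most [a / 2], which contradicts [a <= t * b]. *)
pose t := Num.min e (a / (2 * (`|b| + 1))).
have t0 : 0 < t by rewrite lt_min e0 divr_gt0// mulr_gt0.
have te : t <= e by rewrite ge_min lexx.
have := H t t0 te; apply/negP; rewrite -ltNge.
have tle : t <= a / (2 * (`|b| + 1)) by rewrite ge_min lexx orbT.
have : t * b <= t * (`|b| + 1).
  by rewrite ler_wpM2l ?(ltW t0)// (le_trans (ler_norm _))// lerDl.
move=> /le_lt_trans; apply.
rewrite (@le_lt_trans _ _ (a / 2))//; last by lra.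
by rewrite -ler_pdivlMr// -mulrA -invfM.
Qed.

Lemma differentiable_approx (R : realType) (V W : normedModType R) (f : V -> W)
    (x : V) (e : R) : differentiable f x -> 0 < e ->
  exists2 d : R, 0 < d & forall u, `|u| <= d ->
    `|f (x + u) - f x - 'd f x u| <= e * `|u|.
Proof.
move=> /diff_locally/eqaddoP/(_ e) fx e0.
have /nbhs_normP[d /= d0 fd] := fx e0.
exists (d / 2); first by rewrite divr_gt0.
move=> u ud; have := fd u; rewrite /= sub0r normrN => /(_ _)/=.
rewrite !fctE /= opprD addrA (addrC u x); apply.
by rewrite (le_lt_trans ud)//; lra.
Qed.

(** * Projection onto closed convex sets *)

Section Projection.
Context {R : realType} {X : finHilbertType R}.

Lemma convex_setP (A : set X) : convex_set A <->
  forall (x y : X) (t : R), A x -> A y -> 0 <= t -> t <= 1 ->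
    A (t *: x + (1 - t) *: y).
Proof.
split=> [cA x y t Ax Ay t0 t1|cA x y l]; rewrite ?inE.
  by have := cA x y (Itv01 t0 t1); rewrite !inE => /(_ Ax Ay).
by move=> Ax Ay; exact: cA.
Qed.

Lemma closed_ball_norm (x y : X) (r : R) : 0 < r ->
  closed_ball x r y = (`|x - y| <= r).
Proof. by move=> r0; rewrite closed_ballE. Qed.

Lemma exists_projection (A : set X) (x : X) : A !=set0 -> closed A ->
  convex_set A -> exists2 p, A p & forall y, A y -> dot (x - p) (y - p) <= 0.
Proof.
move=> [a0 Aa0] Acl Acv.
pose f (y : X) := `|x - y|.
have fc : continuous f.
  by move=> y; apply: cvg_norm; apply: cvgB; [exact: cvg_cst|exact: cvg_id].
(* Only points no farther from [x] than [a0] matter, and these form a compact set. *)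
pose B := A `&` [set y | f y <= f a0].
have Bcomp : compact B.
  apply: (@bounded_closed_compact_fd _ _ _ (f a0 + `|x|)).
    move=> y [_ /= fy]; rewrite -[y](subrK x) (le_trans (ler_normD _ _))//.
    by rewrite distrC lerD2r.
  apply: closedI => //.
  have := (continuous_closedP f).1 fc _ (@closed_le _ (f a0)).
  exact.
have [||p pB pmin] := @compact_EVT_min _ _ f B _ Bcomp.
- by exists a0; split => /=.
- exact: continuous_subspaceT.
have [Ap fp] : B p by rewrite inE in pB.
have {}pmin y : A y -> f p <= f y.
  move=> Ay; have [fy|/ltW fy] := leP (f y) (f a0).
    by apply: pmin; rewrite inE.
  exact: le_trans fy.
exists p => // y Ay.
suff : 2 * dot (x - p) (y - p) <= 0 by rewrite pmulr_rle0.
apply: (@le0_of_le_small _ _ (`|y - p| ^+ 2) 1) => // t t0 t1.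
(* Comparing [p] with the point at parameter [t] on the segment towards [y] and dividing by [t]
   leaves the variational inequality up to [t * |y - p|^2]. *)
have := pmin _ ((convex_setP A).1 Acv _ _ _ Ay Ap (ltW t0) t1).
rewrite /f -(ler_pXn2r (n := 2)) ?nnegrE// => fpt.
rewrite -(ler_pM2l t0); move: fpt.
have -> : x - (t *: y + (1 - t) *: p) = (x - p) - t *: (y - p).
  by rewrite scalerBl scale1r scalerBr !opprD !opprK !addrA; congr (_ + _);
     rewrite -!addrA; congr (_ + _); rewrite addrC.
rewrite [leRHS]sqr_normB dotZr normrZ exprMn (gtr0_norm t0); nra.
Qed.

End Projection.

(** * First-order estimates for C^2 maps, and metric regularity *)

Section LinearApproximation.
Context {R : realType} {X V : finHilbertType R}.

(** Each map [y |-> 'd f y b_i] is differentiable at [w], so it moves by O(|y - w|). Expanding [u]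
    in the basis sums these finitely many bounds. One endpoint stays fixed at [w], as
    [first_order_estimate] requires. *)
Lemma diff_lipschitz_at (f : X -> V) (w : X) (U : set X) :
  open U -> U w -> C2_on U f ->
  exists L r : R, [/\ 0 < L, 0 < r & forall y, `|w - y| <= r ->
    differentiable f y /\
    forall u, `|'d f y u - 'd f w u| <= L * `|y - w| * `|u|].
Proof.
move=> Uo Uw [C1 C2].
pose b := vbasis {: X}.
have Ei (i : 'I_(\dim {: X})) : exists g : X, forall u, coord b i u = dot g u.
  exact: (riesz (coord b i)).
pose g i := projT1 (cid (Ei i)).
have gE i u : coord b i u = dot (g i) u by rewrite /g; case: cid.
have lip (i : 'I_(\dim {: X})) : exists C d : R, [/\ 0 < C, 0 < d &
    forall y, `|y - w| <= d -> `|'d f y b`_i - 'd f w b`_i| <= C * `|y - w|].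
  have dw : differentiable (fun y => 'd f y b`_i) w by case: (C2 b`_i w Uw).
  have [C C0 hC] := linear_bounded ('d (fun y => 'd f y b`_i) w).
  have [d d0 hd] := differentiable_approx dw ltr01.
  exists (C + 1), d; split=> //; first by rewrite addr_gt0.
  move=> y yd; have := hd _ yd; rewrite [w + _]addrC subrK => h.
  rewrite -['d f y _ - _](subrK ('d (fun y => 'd f y b`_i) w (y - w))).
  rewrite (le_trans (ler_normD _ _))// mulrDl addrC; exact: lerD.
pose C i := projT1 (cid (lip i)).
have lipC i : exists d, [/\ 0 < C i, 0 < d &
    forall y, `|y - w| <= d -> `|'d f y b`_i - 'd f w b`_i| <= C i * `|y - w|].
  by rewrite /C; case: cid.
have near_lip : \forall y \near w, forall i : 'I_(\dim {: X}),
    `|'d f y b`_i - 'd f w b`_i| <= C i * `|y - w|.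
  apply: filter_forall => i; have [d [_ d0 hd]] := lipC i.
  apply/nbhs_normP; exists d => //= y /= yd; apply: hd.
  by rewrite distrC ltW.
have : \forall y \near w, (forall i : 'I_(\dim {: X}),
    `|'d f y b`_i - 'd f w b`_i| <= C i * `|y - w|) /\ U y.
  by apply: filterI near_lip _; exact: open_nbhs_nbhs.
move=> /nbhs_normP[r /= r0 hr].
exists (1 + \sum_i `|g i| * C i), (r / 2); split.
- rewrite ltr_wpDr// sumr_ge0// => i _; rewrite mulr_ge0//.
  by have [? [/ltW]] := lipC i.
- by rewrite divr_gt0.
move=> y yr; have /hr[hy Uy] : ball_ Num.norm w r y.
  by rewrite /= (le_lt_trans yr)//; lra.
split; first by case: (C1 y Uy).
move=> u.
have expand (T : {linear X -> V}) : T u = \sum_i dot (g i) u *: T b`_i.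
  rewrite [in LHS](coord_vbasis (memvf u)) linear_sum; apply: eq_bigr => i _.
  by rewrite linearZ gE.
rewrite (expand ('d f y)) (expand ('d f w)) -sumrB.
rewrite (le_trans (ler_norm_sum _ _ _))// -mulrA mulrDl mul1r.
rewrite ler_wpDl ?mulr_ge0// mulr_suml; apply: ler_sum => i _.
rewrite -scalerBr normrZ.
have -> : `|g i| * C i * (`|y - w| * `|u|) = (`|g i| * `|u|) * (C i * `|y - w|).
  by ring.
by rewrite ler_pM ?norm_dot_le// hy.
Qed.

(** Pairing with a fixed [e] makes the deviation from [T] along a line a real function, to which the
    mean value theorem applies. *)
Lemma is_derive_line (f : X -> V) (b u : X) (e : V) (s : R) (T : {linear X -> V}) :
  differentiable f (b + s *: u) ->
  is_derive s 1 (fun s : R => dot e (f (b + s *: u) - s *: T u))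
    (dot e ('d f (b + s *: u) u - T u)).
Proof.
move=> df.
have dl : is_diff s (cst b + *:%R^~ u) ( *:%R^~ u).
  exact: is_diff_eq (is_diffD (is_diff_cst b s) (is_diff_scalel s u)) (add0r _).
have dfl := @is_diff_comp _ _ _ _ _ _ f _ s dl (differentiableP df).
have dg := is_diffB dfl (is_diff_scalel s (T u)).
have dote : continuous (dot e : V -> R).
  exact: dot_continuous.
pose p := f (b + s *: u) - s *: T u.
have ddot : is_diff p (dot e : V -> R) (dot e : V -> R).
  by split; [exact: linear_differentiable | exact: diff_lin].
have dall := @is_diff_comp _ _ _ _ _ _ (dot e : V -> R) _ s dg ddot.
have [dd dv] := dall.
split; first exact: diff_derivable.
pose line_comp := (dot e : V -> R) \o (f \o (cst b + *:%R^~ u) - *:%R^~ (T u)).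
have -> : 'D_1 (fun s0 : R => dot e (f (b + s0 *: u) - s0 *: T u)) s =
    'd line_comp s 1 by exact: deriveE.
by rewrite dv /= !fctE /= !scale1r.
Qed.

(** The mean value theorem is applied to the deviation along the segment, paired with the error
    vector [e] itself: the increment over [0,1] is then [|e|^2]. The free radius [m] keeps the
    constant proportional to the distance to [w]. *)
Lemma first_order_estimate (f : X -> V) (w : X) (U : set X) :
  open U -> U w -> C2_on U f ->
  exists L r : R, [/\ 0 < L, 0 < r &
    (forall y, `|w - y| <= r -> differentiable f y) /\
    forall (a b : X) (m : R), m <= r -> `|w - a| <= m -> `|w - b| <= m ->
    `|f a - f b - 'd f w (a - b)| <= L * m * `|a - b|].
Proof.
move=> Uo Uw fC2; have [L [r [L0 r0 H]]] := diff_lipschitz_at Uo Uw fC2.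
exists L, r; split=> //; split=> [y /H[]//|a b m mr am bm].
set e := f a - f b - _.
pose g (s : R) := dot e (f (b + s *: (a - b)) - s *: 'd f w (a - b)).
pose dg (s : R) := dot e ('d f (b + s *: (a - b)) (a - b) - 'd f w (a - b)).
have near_w (s : R) : 0 <= s -> s <= 1 -> `|w - (b + s *: (a - b))| <= m.
  move=> s0 s1; have -> : w - (b + s *: (a - b)) = s *: (w - a) + (1 - s) *: (w - b).
    by vector_ring.
  rewrite (le_trans (ler_normD _ _))// !normrZ ger0_norm// ger0_norm ?subr_ge0//.
  nra.
have drv (s : R) : 0 <= s -> s <= 1 -> is_derive s 1 g (dg s).
  move=> s0 s1; apply: is_derive_line.
  by have [] := H _ (le_trans (near_w s s0 s1) mr).
have [||s] := @MVT_segment R g dg 0 1 ler01.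
- by move=> s; rewrite in_itv/= => /andP[/ltW s0 /ltW s1]; exact: drv.
- apply: derivable_within_continuous => s; rewrite in_itv/= => /andP[s0 s1].
  by have [] := drv s s0 s1.
rewrite in_itv/= => /andP[s0 s1]; rewrite subr0 mulr1.
have -> : g 1 - g 0 = `|e| ^+ 2.
  rewrite /g !scale1r !scale0r addr0 subr0 -dotBr -dotxx.
  have -> : b + (a - b) = a by vector_ring.
  by congr (dot e _); rewrite /e addrAC.
move=> ee; have [e0|e0] := eqVneq e 0.
  by rewrite e0 normr0 !mulr_ge0// ?(ltW L0)// (le_trans (normr_ge0 _) am).
rewrite -(@ler_pM2l _ `|e|) ?normr_gt0// -expr2 ee (le_trans (dot_le _ _))//.
rewrite ler_wpM2l//.
have [_ /(_ (a - b))] := H _ (le_trans (near_w s s0 s1) mr).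
move=> /le_trans; apply; rewrite ler_wpM2r// ler_wpM2l ?(ltW L0)//.
by rewrite distrC near_w.
Qed.

End LinearApproximation.

(* A minimiser of [4 C |f y - k| + |y - y0|] solves [f y = k]: otherwise a
   small step along a preimage of [k - f y] under [T] decreases the value. *)
Lemma metric_regularity (R : realType) (X V : finHilbertType R) (f : X -> V)
    (T : {linear X -> V}) (w : X) (L r C : R) (y0 : X) (k : V) :
  0 < L -> 0 < r -> 0 < C ->
  (forall y, `|w - y| <= r -> {for y, continuous f}) ->
  (forall (a b : X) (m : R), m <= r -> `|w - a| <= m -> `|w - b| <= m ->
     `|f a - f b - T (a - b)| <= L * m * `|a - b|) ->
  (forall v, exists2 u, T u = v & `|u| <= C * `|v|) ->
  L * r * C <= 2^-1 ->
  `|w - y0| + 4 * C * `|f y0 - k| < r ->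
  exists y, [/\ f y = k, `|y - y0| <= 4 * C * `|f y0 - k| & `|w - y| <= r].
Proof.
move=> L0 r0 C0 f_cont f_est T_inv LrC y0r.
have wy0 : `|w - y0| < r.
  by rewrite (le_lt_trans _ y0r)// lerDl !mulr_ge0// ltW.
pose B := [set y : X | `|w - y| <= r].
pose Phi (y : X) := 4 * C * `|f y - k| + `|y - y0|.
have Bcomp : compact B by exact: compact_closed_ball_fd.
have Phi_cont : {within B, continuous Phi}.
  apply: continuous_in_subspaceT => y; rewrite inE => /f_cont fy.
  apply: cvgD.
    apply: cvgM; first exact: cvg_cst.
    by apply: cvg_norm; apply: cvgB; [exact: fy|exact: cvg_cst].
  by apply: cvg_norm; apply: cvgB; [exact: cvg_id|exact: cvg_cst].
have By0 : B y0 by exact: ltW.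
have [|y By ymin] := @compact_EVT_min _ _ Phi B _ Bcomp Phi_cont.
  by exists y0.
have {By} wy : `|w - y| <= r by rewrite inE in By.
have Phiy : Phi y <= 4 * C * `|f y0 - k|.
  by have := ymin y0; rewrite inE => /(_ By0); rewrite {2}/Phi subrr normr0 addr0.
have yy0 : `|y - y0| <= 4 * C * `|f y0 - k|.
  by rewrite (le_trans _ Phiy)// lerDr !mulr_ge0// ltW.
have wy_lt : `|w - y| < r.
  rewrite (le_lt_trans _ y0r)// -[w - y](_ : (w - y0) - (y - y0) = _); last first.
    by vector_ring.
  by rewrite (le_trans (ler_normB _ _))// lerD2l.
exists y; split=> //; apply/eqP; rewrite -subr_eq0; apply/negPn/negP => F0.
set F := f y - k in F0.
have nF : 0 < `|F| by rewrite normr_gt0.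
have [u Tu uC] := T_inv (- F); rewrite normrN in uC.
have CF : 0 < C * `|F| by rewrite mulr_gt0.
(* The minimiser lies strictly inside the ball, which leaves room for a step [s *: u] of positive
   size. *)
pose s := Num.min 1 ((r - `|w - y|) / (C * `|F|)).
have s0 : 0 < s by rewrite lt_min ltr01 divr_gt0// subr_gt0.
have s1 : s <= 1 by rewrite ge_min lexx.
have sr : s * (C * `|F|) <= r - `|w - y|.
  by rewrite -ler_pdivlMr// ge_min lexx orbT.
have su : `|s *: u| <= s * (C * `|F|).
  by rewrite normrZ gtr0_norm// ler_wpM2l// ltW.
have wy' : `|w - (y + s *: u)| <= r.
  rewrite opprD addrA (le_trans (ler_normB _ _))//.
  by have := le_trans su sr; lra.
have := f_est _ _ _ (lexx r) wy' wy.
rewrite [y + _]addrC addrK linearZ/= Tu.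
set G := (X in `|X| <= _) => hG.
have FG : f (s *: u + y) - k = G + (1 - s) *: F.
  by rewrite /G /F; vector_ring.
have : Phi y <= Phi (y + s *: u) by apply: ymin; rewrite inE.
apply/negP; rewrite -ltNge /Phi [y + _]addrC FG -/F.
have h1 : `|G + (1 - s) *: F| <= L * r * `|s *: u| + (1 - s) * `|F|.
  rewrite (le_trans (ler_normD _ _))// normrZ ger0_norm ?subr_ge0//.
  by rewrite lerD2r.
have h2 : L * r * `|s *: u| <= s * `|F| / 2.
  rewrite (@le_trans _ _ (L * r * (s * (C * `|F|))))//.
    by rewrite ler_wpM2l// mulr_ge0// ltW.
  rewrite (_ : L * r * _ = (L * r * C) * (s * `|F|)); last by ring.
  by rewrite [leRHS]mulrC ler_wpM2r// mulr_ge0// ltW.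
have h3 : `|s *: u + y - y0| <= s * (C * `|F|) + `|y - y0|.
  by rewrite -addrA (le_trans (ler_normD _ _))// lerD2r.
have h4 : `|G + (1 - s) *: F| <= `|F| - s * `|F| / 2 by lra.
(* The penalty drops by at least [2 C s |F|] while the distance to [y0] grows by at most [C s |F|];
   the weight [4 * C] is chosen for this net gain. *)
have h5 : 4 * C * `|G + (1 - s) *: F| <= 4 * C * (`|F| - s * `|F| / 2).
  by rewrite ler_wpM2l// mulr_ge0// ltW.
have h6 : 0 < C * (s * `|F|) by rewrite !mulr_gt0.
rewrite (le_lt_trans (lerD h5 h3))//.
rewrite -subr_gt0 (_ : _ - _ = C * (s * `|F|))//.
by field.
Qed.

(** * Normal cones and their calmness at a reducible point *)

Section NormalCone.
Context {R : realType} {X : finHilbertType R}.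

Lemma normal_coneP (D : set X) (z x : X) :
  normal_cone D z x <-> D z /\ forall y, D y -> dot x (y - z) <= 0.
Proof.
rewrite /normal_cone /subdifferential /indicator_function /=; split.
  move=> [zD H]; have {zD} Dz : D z.
    by move: zD; case: ifPn; rewrite ?inE.
  split=> // y Dy; have := H y; rewrite !mem_set// add0e.
  by rewrite lee_fin.
move=> [Dz H]; rewrite mem_set//; split=> // y; rewrite add0e.
by case: ifPn; rewrite ?leey// inE lee_fin => /H.
Qed.

Lemma normal_cone_calm (D : set X) (w : X) : convex_set D -> D w ->
  C2_cone_reducible_at D w ->
  exists r kappa : R, [/\ 0 < r, 0 < kappa & forall z x, `|w - z| <= r ->
    normal_cone D z x ->
    exists2 n, normal_cone D w n & `|x - n| <= kappa * `|w - z| * `|x|].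
Proof.
move=> Dcv Dw [V [K [rho [f [[Kcl Kcv Kcone _] rho0 fw [U [Uo rhoU fC2]]]]]]].
move=> [Tsurj DK].
set T : {linear X -> V} := 'd f w in Tsurj.
have Uw : U w by apply: rhoU; rewrite closed_ball_norm// subrr normr0 ltW.
have [L [r1 [L0 r10 [fdiff fest]]]] := first_order_estimate Uo Uw fC2.
have [C C0 TC] := linear_right_inverse T.
have T_inv v : exists2 u, T u = v & `|u| <= C * `|v|.
  have : range T v by rewrite Tsurj.
  by move=> [x _ <-].
have K0 : K 0 by rewrite -fw; have : (D `&` closed_ball w rho) w; [split=> //;
  rewrite closed_ball_norm// subrr normr0 ltW|rewrite DK; case].
have Kadd a b : K a -> K b -> K (a + b).
  move=> Ka Kb; have -> : a + b = 2 *: (2^-1 *: a + (1 - 2^-1) *: b).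
    have -> : 1 - 2^-1 = 2^-1 :> R by field.
    by rewrite -scalerDr scalerA mulfV ?scale1r.
  apply: Kcone => //; apply: (convex_setP K).1 => //.
  by rewrite invf_le1 ?ler1n.
(* The last term ensures [L * r * C <= 2^-1], the smallness condition of [metric_regularity]. *)
pose r := Num.min rho (Num.min r1 (2 * L * C)^-1).
have r0 : 0 < r by rewrite !lt_min rho0 r10 invr_gt0 !mulr_gt0.
have [r_rho r_r1] : r <= rho /\ r <= r1 by rewrite !ge_min !lexx orbT.
have LrC : L * r * C <= 2^-1.
  have : r <= (2 * L * C)^-1 by rewrite !ge_min lexx !orbT.
  move=> /(ler_wpM2l (ltW (mulr_gt0 L0 C0))); rewrite mulrAC => /le_trans; apply.
  rewrite le_eqVlt (_ : _ == _)//; apply/eqP; field.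
  by rewrite (gt_eqF L0) (gt_eqF C0).
have DKr y : `|w - y| <= r -> D y <-> K (f y).
  move=> yr; have yrho : closed_ball w rho y.
    by rewrite closed_ball_norm// (le_trans yr).
  have /seteqP[h1 h2] := DK; split=> H; first by have [] := h1 y (conj H yrho).
  by have [] := h2 y (conj H yrho).
(* The linearised cone, which plays the part of the tangent cone of [D] at [w]. *)
pose TK := [set u | K (T u)].
have TKcl : closed TK.
  apply: (continuous_closedP T).1 => //; exact: linear_continuous_fd.
have TKcv : convex_set TK.
  apply/convex_setP => a b t Ta Tb t0 t1; rewrite /TK /= linearD !linearZ.
  exact: (convex_setP K).1.
(* The quotients [f (w + t (y - w)) / t] lie in [K] and differ from [T (y - w)] by at most [t * M];
   [K] is closed. *)
have DTK y : D y -> TK (y - w).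
  move=> Dy; apply: Kcl => B /nbhs_normP[e /= e0 eB].
  pose M := L * `|y - w| * `|y - w|.
  have M0 : 0 <= M by rewrite !mulr_ge0// ltW.
  pose t := Num.min 1 (Num.min (r / (`|y - w| + 1)) (e / (M + 1))).
  have M1 : 0 < M + 1 by rewrite ltr_wpDl.
  have y1 : 0 < `|y - w| + 1 by rewrite ltr_wpDl.
  have t0 : 0 < t by rewrite !lt_min ltr01 !divr_gt0.
  have t1 : t <= 1 by rewrite ge_min lexx.
  have tr : t * (`|y - w| + 1) <= r by rewrite -ler_pdivlMr// !ge_min lexx !orbT.
  have te : t * (M + 1) <= e by rewrite -ler_pdivlMr// !ge_min lexx !orbT.
  have wt : w - (t *: y + (1 - t) *: w) = - (t *: (y - w)) by vector_ring.
  have twr : t * `|y - w| <= r by nra.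
  have nwt : `|w - (t *: y + (1 - t) *: w)| = t * `|y - w|.
    by rewrite wt normrN normrZ gtr0_norm.
  have Kf : K (f (t *: y + (1 - t) *: w)).
    by apply/DKr; rewrite ?nwt//; apply: (convex_setP D).1 => //; exact: ltW.
  exists (t^-1 *: f (t *: y + (1 - t) *: w)); split.
    by apply: Kcone => //; rewrite invr_ge0 ltW.
  apply: eB => /=.
  have := fest (t *: y + (1 - t) *: w) w (t * `|y - w|) (le_trans twr r_r1).
  rewrite nwt lexx subrr normr0 => /(_ isT (mulr_ge0 (ltW t0) (normr_ge0 _))).
  rewrite fw subr0 -[_ - w]opprB wt opprK normrZ gtr0_norm// => fT.
  rewrite -(ltr_pM2l t0) -{1}(gtr0_norm t0) -normrZ scalerBr scalerA.
  rewrite mulfV ?gt_eqF// scale1r -linearZ/= distrC (le_lt_trans fT)//.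
  rewrite [X in X < _](_ : _ = t * (t * M)); last by rewrite /M; ring.
  by rewrite ltr_pM2l//; nra.
(* The factor [4 * C] comes from metric regularity and [L] from the first-order error. *)
pose kappa := 4 * C * L.
have kappa0 : 0 < kappa by rewrite !mulr_gt0.
exists (r / 2), kappa; split=> //; first by rewrite divr_gt0.
move=> z x wz /normal_coneP[Dz Nz].
have TK0 : TK 0 by rewrite /TK /= linear0.
(* Moreau decomposition: [u] is the part of [x] in [TK], and [x - u] lies in the polar cone of [TK],
   hence is normal to [D] at [w] because [D - w] is contained in [TK]. *)
have [u TKu Hu] := exists_projection x (ex_intro _ 0 TK0) TKcl TKcv.
have xuu : dot (x - u) u = 0.
  apply/eqP; rewrite eq_le; apply/andP; split.
    have : TK (2 *: u) by rewrite /TK /= linearZ; exact: Kcone.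
    by move=> /Hu; rewrite (_ : 2 *: u - u = u)//; vector_ring.
  by have := Hu 0 TK0; rewrite sub0r dotNr oppr_le0.
have Hu' u' : TK u' -> dot (x - u) u' <= 0.
  by move=> /Hu; rewrite dotBr xuu subr0.
exists (x - u).
  by apply/normal_coneP; split=> // y /DTK; exact: Hu'.
rewrite opprB addrC subrK.
have [->|u0] := eqVneq u 0; first by rewrite normr0 !mulr_ge0// ltW.
have nu : 0 < `|u| by rewrite normr_gt0.
have uu : dot x u = `|u| ^+ 2.
  by move: xuu; rewrite dotBl dotxx => /eqP; rewrite subr_eq0 => /eqP.
(* Since [dot x u = |u|^2], dividing by [|u|] turns this bound into the one on the distance
   [|u|]. *)
suff : dot x u - kappa * `|w - z| * `|x| * `|u| <= 0.
  by rewrite subr_le0 uu expr2 ler_pM2r.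
(* For [t |u| <= r / 8] the start [z + t u] lies within [5 r / 8] of [w] and the correction is at
   most [2 t |u| <= r / 4], so everything stays inside the ball of radius [r]. *)
apply: (@le0_of_le_small _ _ (kappa * `|x| * `|u| * `|u|) (r / (8 * `|u|))).
  by rewrite divr_gt0// mulr_gt0.
move=> t t0; rewrite ler_pdivlMr ?mulr_gt0// => tr.
have tu : `|t *: u| = t * `|u| by rewrite normrZ gtr0_norm.
have tu8 : t * `|u| <= r / 8 by lra.
set m := `|w - z| + t * `|u|.
have m0 : 0 <= m by rewrite addr_ge0// mulr_ge0// ltW.
have mr : m <= r by rewrite /m; lra.
have wy0 : `|w - (z + t *: u)| <= m.
  by rewrite opprD addrA (le_trans (ler_normB _ _))// tu.
have wzm : `|w - z| <= m by rewrite lerDl mulr_ge0// ltW.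
have := fest _ _ _ (le_trans mr r_r1) wy0 wzm.
have -> : z + t *: u - z = t *: u by vector_ring.
rewrite tu => res.
have res' : `|f (z + t *: u) - (f z + T (t *: u))| <= L * m * (t * `|u|).
  by rewrite opprD addrA.
have rest : 4 * C * (L * m * (t * `|u|)) <= 2 * (t * `|u|).
  rewrite mulrA ler_wpM2r ?mulr_ge0 ?(ltW t0)//.
  have : L * m * C <= L * r * C by rewrite ler_wpM2r ?(ltW C0)// ler_wpM2l// ltW.
  by lra.
have C4 : 4 * C * `|f (z + t *: u) - (f z + T (t *: u))|
    <= 4 * C * (L * m * (t * `|u|)).
  by rewrite ler_wpM2l// mulr_ge0// ltW.
have fc y : `|w - y| <= r -> {for y, continuous f}.
  by move=> yr; apply: differentiable_continuous; apply: fdiff; exact: le_trans r_r1.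
have fest' a b k : k <= r -> `|w - a| <= k -> `|w - b| <= k ->
    `|f a - f b - T (a - b)| <= L * k * `|a - b|.
  by move=> kr; apply: fest; exact: le_trans r_r1.
(* The target value [f z + T (t u)] is a sum of two elements of [K], so the solution [y] belongs to
   [D]. *)
have [|y [fy yy0 wy]] :=
    @metric_regularity _ _ _ f T w L r C (z + t *: u) (f z + T (t *: u))
      L0 r0 C0 fc fest' T_inv LrC.
  rewrite (le_lt_trans (lerD wy0 (le_trans C4 rest)))// /m.
  by lra.
have Dy : D y.
  apply/DKr => //; rewrite fy linearZ; apply: Kadd.
    by apply/DKr => //; rewrite (le_trans wz)//; lra.
  by apply: Kcone => //; exact: ltW.
have := Nz _ Dy.
have -> : y - z = t *: u + (y - (z + t *: u)) by vector_ring.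
rewrite dotDr dotZr => xt.
have := norm_dot_le x (y - (z + t *: u)); rewrite ler_norml => /andP[xn _].
have xb : `|x| * `|y - (z + t *: u)| <= `|x| * (4 * C * (L * m * (t * `|u|))).
  by rewrite ler_wpM2l// (le_trans yy0).
have tt : t * dot x u <= t * (kappa * m * `|x| * `|u|).
  rewrite (_ : t * (kappa * _ * _ * _) = `|x| * (4 * C * (L * m * (t * `|u|)))).
    by lra.
  by rewrite /kappa; ring.
move: tt; rewrite ler_pM2l// /m => tt.
rewrite lerBlDr (le_trans tt)// le_eqVlt; apply/orP; left; apply/eqP; ring.
Qed.

End NormalCone.

(** * Support functions and the subdifferential sum rule *)

Section SupportFunction.
Context {R : realType} {X : finHilbertType R}.
Local Open Scope ereal_scope.

Lemma support_function_ge (D : set X) (x z : X) : D z ->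
  (dot x z)%:E <= support_function D x.
Proof. by move=> Dz; apply: ereal_sup_ubound; exists z. Qed.

Lemma support_function_le (D : set X) (x : X) (r : R) :
  (forall z, D z -> (dot x z <= r)%R) -> support_function D x <= r%:E.
Proof.
by move=> H; apply: ge_ereal_sup => _ [z Dz <-]; rewrite lee_fin; exact: H.
Qed.

Lemma support_function_normal (D : set X) (x z : X) : normal_cone D z x ->
  support_function D x = (dot x z)%:E.
Proof.
move=> /normal_coneP[Dz Nz]; apply/eqP; rewrite eq_le support_function_ge//.
rewrite andbT; apply: support_function_le => y /Nz.
by rewrite dotBr subr_le0.
Qed.

Lemma lower_semicontinuous_support (D : set X) (F : X -> R) : continuous F ->
  lower_semicontinuous (fun x => (F x)%:E + support_function D x).
Proof.
move=> Fc x a aF.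
have /ereal_sup_gt[_ [z Dz <-]] : (a - F x)%:E < support_function D x.
  by rewrite EFinB lteBlDl.
rewrite lte_fin ltrBlDl => aFx.
exists [set y | (a < F y + dot y z)%R].
  have Gc : continuous (fun y => F y + dot y z)%R.
    move=> y; apply: cvgD; first exact: Fc.
    under eq_fun do rewrite dotC; rewrite dotC; exact: dot_continuous.
  exact: (cvgr_gt _ (Gc x)).
move=> y /= ay.
rewrite (@lt_le_trans _ _ (F y + dot y z)%:E) ?lte_fin//.
by rewrite EFinD leeD2l// support_function_ge.
Qed.

Lemma normal_cone_of_subdifferential (D : set X) (F : X -> R) (x g xi : X) :
  D !=set0 -> closed D -> convex_set D -> differentiable F x ->
  (forall u, 'd F x u = dot g u) ->
  subdifferential (fun x => (F x)%:E + support_function D x) x xi ->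
  normal_cone D (xi - g)%R x.
Proof.
move=> [z0 Dz0] Dcl Dcv dF gF [hx Hxi].
have [s sE] : exists s, support_function D x = s%:E.
  move: hx; rewrite fin_numD => /andP[_].
  by case: (support_function D x) => // s _; exists s.
have sz z : D z -> (dot x z <= s)%R.
  by move=> Dz; rewrite -lee_fin -sE; exact: support_function_ge.
set zeta := (xi - g)%R.
(* A real upper bound [r] replaces the support function at [y], which may be infinite. The
   subgradient inequality is used at [x + t (y - x)], where convexity bounds the support function,
   and is divided by [t]. *)
have key (y : X) (r : R) : (forall z, D z -> dot y z <= r)%R ->
    (s + dot zeta (y - x) <= r)%R.
  move=> yr; rewrite -subr_le0.
  suff small e : (0 < e -> s + dot zeta (y - x) - r <= e * `|y - x|)%R.
    by apply: (@le0_of_le_small _ _ `|y - x|%R 1%R) => // t t0 _; exact: small.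
  move=> e0; have [d d0 Hd] := differentiable_approx dF e0.
  pose t : R := Num.min 1%R (d / (`|y - x| + 1))%R.
  have y1 : (0 < `|y - x| + 1)%R by rewrite ltr_wpDl.
  have t0 : (0 < t)%R by rewrite lt_min ltr01 divr_gt0.
  have t1 : (t <= 1)%R by rewrite ge_min lexx.
  have td : (t * (`|y - x| + 1) <= d)%R.
    by rewrite -ler_pdivlMr// ge_min lexx orbT.
  have ntu : (`|t *: (y - x)| = t * `|y - x|)%R by rewrite normrZ gtr0_norm.
  have := Hd (t *: (y - x))%R; rewrite ntu gF dotZr.
  move=> /(_ _)/wrap[]; first by nra.
  rewrite ler_norml => /andP[_ Ft].
  have := Hxi (x + t *: (y - x))%R; rewrite sE.
  have -> : (x + t *: (y - x) - x = t *: (y - x))%R by vector_ring.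
  rewrite dotZr.
  have st : support_function D (x + t *: (y - x))%R <= (s + t * (r - s))%:E.
    apply: support_function_le => z Dz.
    rewrite dotDl dotZl dotBl.
    have := yr z Dz; have := sz z Dz; nra.
  move=> /le_trans/(_ (leeD2l _ st)).
  rewrite -!EFinD lee_fin => Fs.
  rewrite -(ler_pM2l t0) /zeta dotBl; nra.
(* The points [2 x] and [0] give the two inequalities. *)
have s0 : (dot x zeta = s)%R.
  apply/eqP; rewrite eq_le; apply/andP; split.
    have := key (2 *: x)%R (2 * s)%R; have -> : (2 *: x - x = x)%R by vector_ring.
    move=> /(_ _)/wrap[] => [z /sz|]; first by rewrite dotZl; lra.
    by rewrite dotC; lra.
  have := key 0%R 0%R; rewrite sub0r dotNr (dotC zeta).
  by move=> /(_ _)/wrap[] => [z _|]; rewrite ?dot0l//; lra.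
have key' (y : X) (r : R) : (forall z, D z -> dot y z <= r)%R ->
    (dot zeta y <= r)%R.
  by move=> /key; rewrite dotBr (dotC zeta x) s0; lra.
have [p Dp Hp] := @exists_projection _ _ D zeta (ex_intro _ _ Dz0) Dcl Dcv.
have zp : zeta = p.
  (* The direction [zeta - p] would separate [zeta] from [D]; its bound forces
     [|zeta - p|^2 <= 0]. *)
  have := key' (zeta - p)%R (dot (zeta - p) p)%R.
  move=> /(_ _)/wrap[] => [z /Hp|]; first by rewrite dotBr subr_le0.
  rewrite (dotC zeta) -subr_le0 -dotBr dotxx => zp.
  have : (`|zeta - p| ^+ 2 == 0)%R by rewrite eq_le zp sqr_ge0.
  by rewrite sqrf_eq0 normr_eq0 subr_eq0 => /eqP.
apply/normal_coneP; split; first by rewrite zp.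
by move=> y /sz; rewrite dotBr s0 subr_le0.
Qed.

End SupportFunction.

(** * Gradients, adjoints and strong convexity *)

Section SmoothPart.
Context {R : realType} {X Y : finHilbertType R}.

(** [riesz] supplies a representative, so [xget] never falls back on its default [0]. *)
Lemma gradP (f : X -> R) (x u : X) : 'd f x u = dot (grad f x) u.
Proof.
move: u; rewrite /grad; case: xgetP => [g -> //|noriesz].
by have [g gE] := riesz ('d f x); case: (noriesz g).
Qed.

Lemma adjointP (A : {linear X -> Y}) (y : Y) (u : X) :
  dot (A u) y = dot u (adjoint A y).
Proof.
move: u; rewrite /adjoint; case: xgetP => [x -> //|noriesz].
have lin : linear (fun u => dot (A u) y : R^o).
  by move=> k u v; rewrite linearP dotDl dotZl.
pose L := GRing.isLinear.Build _ _ _ _ (fun u => dot (A u) y : R^o) lin.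
pose f : {scalar X} := HB.pack (fun u => dot (A u) y : R^o) L.
have [g gE] := riesz f; case: (noriesz g) => u /=.
by rewrite [RHS]dotC -gE.
Qed.

(** Pairing the difference [d] with itself moves the adjoint back to [A d]. *)
Lemma adjointB_le (A : {linear X -> Y}) (C : R) (y1 y2 : Y) :
  0 < C -> (forall u, `|A u| <= C * `|u|) ->
  `|adjoint A y1 - adjoint A y2| <= C * `|y1 - y2|.
Proof.
move=> C0 AC; set d := _ - _; have [->|d0] := eqVneq d 0.
  by rewrite normr0 mulr_ge0// ltW.
rewrite -(@ler_pM2l _ `|d|) ?normr_gt0// -expr2 -dotxx {2}/d dotBr -!adjointP.
rewrite -dotBr (le_trans (dot_le _ _))// mulrA [`|d| * C]mulrC.
by rewrite ler_wpM2r.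
Qed.

Lemma locally_lipschitz_at (f : X -> Y) (x : X) : locally_lipschitz f ->
  exists L d : R, [/\ 0 < L, 0 < d & forall y, `|x - y| <= d ->
    `|f x - f y| <= L * `|x - y|].
Proof.
move=> /(_ x)[U /[dup]/nbhs_singleton Ux /nbhs_normP[d /= d0 dU]].
move=> /pinfty_ex_gt0[L L0 HL]; exists L, (d / 2); split=> //.
  by rewrite divr_gt0.
move=> y yd; apply: (HL (x, y)); split=> //=; apply: dU => /=.
by rewrite (le_lt_trans yd)//; lra.
Qed.

Lemma strongly_convex_gradient (K : set X) (f : X -> R) (mu : R) (x y : X) :
  (forall (x y : X) (t : R), K x -> K y -> 0 <= t <= 1 ->
    f (t *: x + (1 - t) *: y) <=
      t * f x + (1 - t) * f y - mu / 2 * t * (1 - t) * `|x - y| ^+ 2) ->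
  0 < mu -> K x -> K y -> differentiable f x ->
  f x + dot (grad f x) (y - x) + mu / 2 * `|y - x| ^+ 2 <= f y.
Proof.
move=> fK mu0 Kx Ky df; rewrite -subr_le0.
set n := `|y - x|.
pose b := n + mu / 2 * n ^+ 2.
suff small e : 0 < e ->
    f x + dot (grad f x) (y - x) + mu / 2 * n ^+ 2 - f y <= e * b.
  by apply: (@le0_of_le_small _ _ b 1) => // t t0 _; exact: small.
move=> e0; have [d d0 Hd] := differentiable_approx df e0.
have n1 : 0 < n + 1 by rewrite ltr_wpDl// normr_ge0.
(* The bound [t <= e] absorbs the factor [1 - t] of the quadratic term, and the bound by
   [d / (n + 1)] makes the differential accurate to [e * t * n]. *)
pose t : R := Num.min 1 (Num.min e (d / (n + 1))).
have t0 : 0 < t by rewrite !lt_min ltr01 e0 divr_gt0.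
have t1 : t <= 1 by rewrite ge_min lexx.
have te : t <= e by rewrite !ge_min lexx orbT.
have td : t * (n + 1) <= d by rewrite -ler_pdivlMr// !ge_min lexx !orbT.
have ntu : `|t *: (y - x)| = t * n by rewrite normrZ gtr0_norm.
have := Hd (t *: (y - x)); rewrite ntu gradP dotZr.
move=> /(_ _)/wrap[]; first by nra.
rewrite ler_norml => /andP[Ft _].
have := fK y x t Ky Kx; rewrite (ltW t0) t1 => /(_ isT).
have -> : t *: y + (1 - t) *: x = x + t *: (y - x) by vector_ring.
rewrite -/n => fxt.
rewrite -(ler_pM2l t0) /b.
have h : mu / 2 * n ^+ 2 * t <= mu / 2 * n ^+ 2 * e.
  by rewrite ler_wpM2l// mulr_ge0 ?sqr_ge0// divr_ge0// ltW.
have {}h := ler_wpM2l (ltW t0) h.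
by lra.
Qed.

(** Adding the first-order inequalities at [x] and at [y] cancels the values of [f]. *)
Lemma strongly_convex_monotone (K : set X) (f : X -> R) :
  strongly_convex_on K f -> (forall x, differentiable f x) ->
  exists2 mu : R, 0 < mu & forall x y, K x -> K y ->
    mu * `|x - y| ^+ 2 <= dot (grad f x - grad f y) (x - y).
Proof.
move=> [mu mu0 fK] df; exists mu => // x y Kx Ky.
have yx : y - x = - (x - y) by rewrite opprB.
have h1 := strongly_convex_gradient fK mu0 Kx Ky (df x).
have h2 := strongly_convex_gradient fK mu0 Ky Kx (df y).
rewrite yx dotNr normrN in h1; rewrite dotBl.
move: h1 h2; move: (f x) (f y) (dot _ _) (dot _ _) (`|_| ^+ 2) => a b p q n.
by lra.
Qed.

Lemma convex_closed_ball (x : X) (r : R) : convex_set [set y | `|x - y| <= r].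
Proof.
apply/convex_setP => a b t /= ra rb t0 t1.
have -> : x - (t *: a + (1 - t) *: b) = t *: (x - a) + (1 - t) *: (x - b).
  by vector_ring.
rewrite (le_trans (ler_normD _ _))// !normrZ ger0_norm// ger0_norm ?subr_ge0//.
nra.
Qed.

Lemma derive1_sqrt_powR (c s : R) : 0 < s ->
  derive1 (fun s : R => c * s `^ (1 - 2^-1)) s = c / (2 * Num.sqrt s).
Proof.
move=> s0.
have -> : 1 - 2^-1 = 2^-1 :> R by field.
have dp := is_derive1_powR 2^-1 s0.
rewrite derive1E; have [_ ->] := is_deriveZ c dp.
have -> : 2^-1 - 1 = - 2^-1 :> R by field.
by rewrite powRN powR12_sqrt ?(ltW s0)// invfM.
Qed.

End SmoothPart.

(** * From a quadratic growth bound to the exponent 1/2 *)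

Lemma quadratic_bound (R : realFieldType) (mu P Q s e d : R) :
  0 < mu -> 0 <= P -> 0 <= Q -> 0 <= s -> 0 <= e ->
  mu * s ^+ 2 <= e * (P * s + Q * e) -> d <= e * (P * s + Q * e) ->
  d <= (P * ((P + Q) / mu + 1) + Q) * e ^+ 2.
Proof.
move=> mu0 P0 Q0 s0 e0 sb db.
pose G := (P + Q) / mu + 1.
have PQ0 : 0 <= (P + Q) / mu by rewrite divr_ge0 ?addr_ge0// ltW.
have sG : s <= G * e.
  (* If [e < s], then [Q e <= Q s] and the hypothesis can be divided by [s]; the [+ 1] in [G] covers
     the case [s <= e]. *)
  have [se|es] := leP s e.
    by rewrite (le_trans se)// ler_peMl// lerDr.
  have s_gt0 : 0 < s by rewrite (le_lt_trans e0).
  rewrite (@le_trans _ _ ((P + Q) / mu * e))//; last by rewrite ler_wpM2r// lerDl.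
  rewrite mulrAC ler_pdivlMr// mulrC -(ler_pM2l s_gt0).
  rewrite (_ : s * (mu * s) = mu * s ^+ 2); last by ring.
  rewrite (le_trans sb)// (_ : s * _ = e * (P * s + Q * s)); last by ring.
  by rewrite ler_wpM2l// lerD2l ler_wpM2l// ltW.
rewrite (le_trans db)// (_ : _ * e ^+ 2 = e * (P * (G * e) + Q * e)).
  by rewrite ler_wpM2l// lerD2r ler_wpM2l.
by rewrite /G; ring.
Qed.

(** With [phi s = 2 sqrt H sqrt s], the KL inequality reads [h x - h xbar <= H |xi|^2]. The range
    [a = H eps^2] makes it automatic for subgradients longer than [eps]. *)
Lemma KL_half_of_gradient_bound (R : realType) (X : finHilbertType R)
    (h : X -> \bar R) (xbar : X) (H eps : R) :
  Defs.proper h -> lower_semicontinuous h -> subdifferential h xbar !=set0 ->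
  0 < H -> 0 < eps ->
  (\forall x \near xbar, forall xi, subdifferential h x xi -> `|xi| <= eps ->
     (h x <= h xbar + (H * `|xi| ^+ 2)%:E)%E) ->
  KL_property h 2^-1 xbar.
Proof.
move=> hp hlsc hsub H0 eps0 bound.
have [hb hbE] : exists hb, h xbar = hb%:E.
  by case: hsub => g [/fineK <- _]; exists (fine (h xbar)).
have c0 : 0 < 2 * Num.sqrt H by rewrite mulr_gt0// sqrtr_gt0.
split=> //; first by rewrite invr_ge0 ler0n invf_lt1 ?ltr1n.
exists (H * eps ^+ 2)%:E, (2 * Num.sqrt H).
exists [set x | forall xi, subdifferential h x xi -> `|xi| <= eps ->
     (h x <= h xbar + (H * `|xi| ^+ 2)%:E)%E].
split=> //; first by rewrite lte_fin mulr_gt0// exprn_gt0.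
move=> x /= xV; rewrite hbE -EFinD => hx hxa.
have [hv hvE] : exists hv, h x = hv%:E.
  by move: hx hxa; case: (h x) => // hv _ _; exists hv.
rewrite hvE -EFinB /=; move: hx hxa; rewrite hvE !lte_fin => hx hxa.
have D0 : 0 < hv - hb by rewrite subr_gt0.
rewrite derive1_sqrt_powR// -mulf_div mulfV ?pnatr_eq0// mul1r.
set q := _ / _.
have q0 : 0 < q by rewrite divr_gt0// sqrtr_gt0.
have -> : (1 = q%:E * q^-1%:E)%E by rewrite -EFinM mulfV// gt_eqF.
apply: lee_wpmul2l; first by rewrite lee_fin ltW.
apply/ereal_infP => _ [xi xixi <-]; rewrite lee_fin sub0r normrN.
rewrite /q invf_div ler_pdivrMr ?sqrtr_gt0// mulrC.
have -> : `|xi| = Num.sqrt (`|xi| ^+ 2) by rewrite sqrtr_sqr normr_id.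
rewrite -sqrtrM ?(ltW H0)// ler_sqrt; last first.
  by rewrite mulr_ge0 ?sqr_ge0// ltW.
have [xe|ex] := leP `|xi| eps.
  by have := xV xi xixi xe; rewrite hvE hbE -EFinD lee_fin; lra.
have : H * eps ^+ 2 <= H * `|xi| ^+ 2.
  by rewrite ler_wpM2l ?(ltW H0)// ler_pXn2r ?nnegrE ?(ltW eps0) ?(ltW ex)//.
by move: hxa; lra.
Qed.

Lemma differentiable_composite (R : realType) (X Y : finHilbertType R)
    (ell : Y -> R) (A : {linear X -> Y}) (v x : X) :
  differentiable ell (A x) ->
  let F := fun x : X => ell (A x) + dot v x in
  differentiable F x /\
  forall u, 'd F x u = dot (adjoint A (grad ell (A x)) + v) u.
Proof.
move=> dell F.
have dA : is_diff x A A.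
  split; first by apply: linear_differentiable; exact: linear_continuous_fd.
  by apply: diff_lin; exact: linear_continuous_fd.
have dv : is_diff x (dot v : X -> R) (dot v : X -> R).
  by split; [apply: linear_differentiable|apply: diff_lin]; exact: dot_continuous.
have dl := @is_diff_comp _ _ _ _ _ _ ell _ x dA (differentiableP dell).
have [dF dFE] := is_diffD dl dv.
split; first exact: dF.
move=> u; have -> : 'd F x u = 'd ((ell \o A) + (dot v : X -> R)) x u by [].
by rewrite dFE /= fctE /= gradP dotDl [dot (grad _ _) _]dotC adjointP dotC.
Qed.

(** * Normality of [xbar] and the KL exponent of [h] *)

Theorem theorem4p4 (R : realType) (X Y : finHilbertType R)
    (ell : Y -> R) (A : {linear X -> Y}) (v : X) (D : set X) (xbar : X)
    (ell_strongly_convex : forall K : set Y,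
       compact K -> convex_set K -> strongly_convex_on K ell)
    (ell_differentiable : forall y, differentiable ell y)
    (ell_lipschitz_grad : locally_lipschitz (grad ell))
    (D_nonempty : D !=set0) (D_closed : closed D) (D_convex : convex_set D)
    (D_reducible : C2_cone_reducible D) :
  let h : X -> \bar R :=
    fun x => ((ell (A x) + dot v x)%:E + support_function D x)%E in
  let w : X := - adjoint A (grad ell (A xbar)) - v in
  subdifferential h xbar 0 ->
  normal_cone D w xbar /\
  (boundedly_linearly_regular (A @^-1` [set A xbar]) (normal_cone D w) xbar ->
   KL_property h 2^-1 xbar).
Proof.
move=> h w h0.
pose F x := ell (A x) + dot v x.
pose g x := adjoint A (grad ell (A x)).
have dF x := differentiable_composite v (ell_differentiable (A x)).
have subN x xi : subdifferential h x xi -> normal_cone D (xi - (g x + v)) x.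
  exact: normal_cone_of_subdifferential (dF x).1 (dF x).2.
have wE : w = - (g xbar + v) by rewrite opprD.
have Nw : normal_cone D w xbar by rewrite wE -[- _]add0r; exact: subN.
have [CA CA0 AC] := linear_bounded A.
split=> // -[_ blr].
have hE x : h x = ((F x)%:E + support_function D x)%E by [].
have gE x u : dot u (g x) = dot (A u) (grad ell (A x)) by rewrite adjointP.
have gB x y : `|g x - g y| <= CA * `|grad ell (A x) - grad ell (A y)|.
  exact: adjointB_le.
clearbody w h g.
have [Dw _] := (normal_coneP _ _ _).1 Nw.
have [C1 C10 AC1] := linear_right_inverse A.
(* The ball of radius [CA] about [A xbar] contains [A x] whenever [|xbar - x| <= 1]. *)
have [mu mu0 mono] := strongly_convex_monotone
  (ell_strongly_convex _ (@compact_closed_ball_fd _ _ (A xbar) CA)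
     (@convex_closed_ball _ _ (A xbar) CA)) ell_differentiable.
have [L [dl [L0 dl0 lip]]] := locally_lipschitz_at (A xbar) ell_lipschitz_grad.
have [r [kappa [r0 kappa0 calm]]] := normal_cone_calm D_convex Dw (D_reducible w Dw).
pose U := [set x | `|xbar - x| <= 1].
have UM x : U x -> `|x| <= `|xbar| + 1.
  move=> Ux; rewrite -[x](subrK xbar) (le_trans (ler_normD _ _))//.
  by rewrite addrC distrC lerD2l.
have Unbhs : nbhs xbar U.
  by apply/nbhs_normP; exists 1 => //= x /= /ltW.
have Ubnd : bounded_set U.
  exists (`|xbar| + 1); split=> [|N MN x /= Ux]; first exact: num_real.
  by rewrite (le_trans (UM _ Ux))// ltW.
have {blr} [c c0 blr] := blr U Unbhs Ubnd.
pose M := `|xbar| + 1.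
have M0 : 0 < M by rewrite ltr_wpDl.
(* [P s + Q |xi|] collects [c] times the distance bounds to the fibre of [A] and to the normal cone,
   with [s = |A xbar - A x|]. *)
pose P := c * (C1 + kappa * M * (CA * L)).
pose Q := c * (kappa * M).
have P0 : 0 < P by rewrite mulr_gt0// addr_gt0// !mulr_gt0.
have Q0 : 0 < Q by rewrite !mulr_gt0.
(* [h] is constant on the intersection: the support function at [p] equals [dot p w], whose [v] part
   cancels [dot v p]. *)
have hS p : A p = A xbar -> normal_cone D w p ->
    h p = (ell (A xbar) - dot (A xbar) (grad ell (A xbar)))%:E.
  move=> Ap Np; rewrite hE (support_function_normal Np) -EFinD; congr (_%:E).
  by rewrite /F wE dotNr dotDr gE Ap (dotC p v); ring.
have hxb : h xbar = (ell (A xbar) - dot (A xbar) (grad ell (A xbar)))%:E.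
  exact: hS.
have hproper : Defs.proper h.
  split; last by exists xbar; rewrite hxb ltry.
  move=> x; have [z Dz] := D_nonempty.
  rewrite gt_eqF// hE (@lt_le_trans _ _ ((F x)%:E + (dot x z)%:E)%E)//.
    by rewrite -EFinD ltNyr.
  by rewrite leeD2l// support_function_ge.
have hlsc : lower_semicontinuous h.
  rewrite (funext hE); apply: lower_semicontinuous_support => x.
  exact: differentiable_continuous (dF x).1.
apply: (@KL_half_of_gradient_bound _ _ h xbar
  (P * ((P + Q) / mu + 1) + Q) (r / 2)) => //.
- by exists 0.
- by rewrite addr_gt0// mulr_gt0// addr_gt0// divr_gt0// addr_gt0.
- by rewrite divr_gt0.
(* The three bounds keep [A x] in the strong convexity ball, within the Lipschitz radius [dl], and
   with [CA * L * s <= r / 2]. With [|xi| <= r / 2] this puts [z] within the calmness radius. *)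
pose eta := Num.min 1 (Num.min (dl / CA) (r / (2 * (CA * L * CA)))).
have eta0 : 0 < eta by rewrite !lt_min ltr01 !divr_gt0// !mulr_gt0.
apply/nbhs_normP; exists eta => //= x /= /ltW xeta xi xixi xie.
have Ux : U x by rewrite /U /= (le_trans xeta)// ge_min lexx.
set s := `|A xbar - A x|.
have sle : s <= CA * `|xbar - x| by rewrite /s -linearB.
have s0 : 0 <= s by exact: normr_ge0.
have sdl : s <= dl.
  rewrite (le_trans sle)// mulrC -ler_pdivlMr// (le_trans xeta)//.
  by rewrite !ge_min lexx orbT.
have sr : CA * L * s <= r / 2.
  have : `|xbar - x| <= r / (2 * (CA * L * CA)).
    by rewrite (le_trans xeta)// !ge_min lexx !orbT.
  rewrite ler_pdivlMr ?mulr_gt0// => xr.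
  have : CA * L * s <= CA * L * (CA * `|xbar - x|).
    by rewrite ler_wpM2l// ltW// mulr_gt0.
  by lra.
have sCA : s <= CA.
  by rewrite (le_trans sle)// ler_piMr// ltW.
have Nx := subN x xi xixi.
have [z zE] : exists z, z = xi - (g x + v) by exists (xi - (g x + v)).
rewrite -zE in Nx.
have wz : `|w - z| <= `|xi| + CA * L * s.
  have -> : w - z = (g x - g xbar) - xi by rewrite wE zE; vector_ring.
  rewrite (le_trans (ler_normB _ _))// addrC lerD2l.
  rewrite (le_trans (gB _ _))// -mulrA ler_wpM2l ?(ltW CA0)//.
  by rewrite distrC lip.
have wzr : `|w - z| <= r by lra.
have [n Nn xn] := calm z x wzr Nx.
(* Subtracting [u] brings [x] into the fibre of [A xbar] at cost O(s). *)
have [u Au uC] := AC1 (x - xbar).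
have xn' : `|x - n| <= kappa * M * (`|xi| + CA * L * s).
  rewrite (le_trans xn)// mulrAC ler_pM// ?mulr_ge0 ?(ltW kappa0)//.
  by rewrite ler_wpM2l ?(ltW kappa0)// UM.
have us : `|u| <= C1 * s.
  by rewrite (le_trans uC)// linearB distrC.
set S := (A @^-1` [set A xbar]) `&` normal_cone D w.
set B := P * s + Q * `|xi|.
have distS : (dist x S <= B%:E)%E.
  have d1 : (dist x (A @^-1` [set A xbar]) <= (C1 * s)%:E)%E.
    apply: (@le_trans _ _ `|x - (x - u)|%:E).
      apply: ereal_inf_lbound; exists (x - u) => //=.
      by rewrite linearB Au linearB; vector_ring.
    by rewrite lee_fin subKr.
  have d2 : (dist x (normal_cone D w) <= (kappa * M * (`|xi| + CA * L * s))%:E)%E.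
    apply: (@le_trans _ _ `|x - n|%:E); last by rewrite lee_fin.
    by apply: ereal_inf_lbound; exists n.
  apply: (le_trans (blr x Ux)).
  apply: (@le_trans _ _ (c%:E * (C1 * s + kappa * M * (`|xi| + CA * L * s))%:E)%E).
    by apply: lee_wpmul2l; [rewrite lee_fin ltW|rewrite EFinD leeD].
  rewrite -EFinM lee_fin le_eqVlt; apply/orP; left; apply/eqP.
  by rewrite /B /P /Q; ring.
have [hv hvE] : exists hv, h x = hv%:E.
  by case: xixi => /fineK <- _; exists (fine (h x)).
set hb := ell (A xbar) - _ in hxb.
rewrite hvE hxb -EFinD lee_fin -lerBlDl.
(* The distance is an infimum, so points of [S] are taken within [B + d], and [d] tends to zero at
   the end. *)
have near_S (d : R) : 0 < d -> exists2 p, S p & `|x - p| < B + d.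
  move=> d0; have /ereal_inf_lt[_ [p Sp <-]] : (dist x S < (B + d)%:E)%E.
    by rewrite (le_lt_trans distS)// lte_fin ltrDl.
  by rewrite lte_fin; exists p.
have upS p : S p -> mu * s ^+ 2 <= `|xi| * `|x - p| /\
    hv - hb <= `|xi| * `|x - p|.
  move=> [/= Ap Np]; have xip := dot_le xi (x - p).
  split; last first.
    have [_ /(_ p)] := xixi; rewrite hvE (hS p Ap Np) -EFinD lee_fin.
    by rewrite -(opprB x p) dotNr -/hb; lra.
  rewrite (le_trans _ xip)//.
  have sE : `|A x - A xbar| = s by rewrite /s distrC.
  have xbarK : `|A xbar - A xbar| <= CA by rewrite subrr normr0 ltW.
  (* The adjoint turns the right side into [dot (xi - (z - w)) (x - p)], and monotonicity of the
     normal cone discards the [z - w] part. *)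
  have := mono (A x) (A xbar) sCA xbarK; rewrite sE => /le_trans; apply.
  rewrite -Ap -linearB dotC dotBr Ap -!gE -dotBr.
  have [Dz /(_ w Dw)] := (normal_coneP _ _ _).1 Nx.
  have [_ /(_ z Dz)] := (normal_coneP _ _ _).1 Np.
  have -> : g x - g xbar = xi - (z - w) by rewrite wE zE; vector_ring.
  rewrite (dotC xi); move: (x) (p) (xi) => a b e; rewrite !dotBr !dotBl.
  move: (dot a z) (dot a w) (dot b z) (dot b w) (dot a e) (dot b e).
  by move=> az aw bz bw ae be; lra.
apply: (quadratic_bound mu0 (ltW P0) (ltW Q0) s0 (normr_ge0 _)).
all: rewrite -subr_le0; apply: (@le0_of_le_small _ _ `|xi| 1) => // d d0 _.
all: have [p Sp xp] := near_S d d0; have [up1 up2] := upS p Sp.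
all: have := ler_wpM2l (normr_ge0 xi) (ltW xp); rewrite /B.
all: lra.
Qed.
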